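(* Let $\{f(\cdot;\theta)\}_{\theta\in\Theta}$ be a one-parameter statistical model satisfying the standing assumptions in the context. Fix the true parameter value $\theta$ and let $T(X)$, $X\sim P_\theta$, be an estimator of the scalar parameter which is unbiased in a neighbourhood of $\theta$. Put $Z_0(X):=T(X)-\theta$, $\widetilde Z_0:=Z_0 s_\theta\in L^2(\mu)$, $\mathcal T_1:=\operatorname{span}\{\eta_1\}\subset L^2(\mu)$, $R_1:=\widetilde Z_0-\operatorname{Proj}_{\mathcal T_1}\widetilde Z_0\in\mathcal T_1^\perp$, $\mathcal I(\theta)=\mathbb E_\theta[Y_1^2]$, and $$\mathrm{II}(\eta_1,\eta_1):=\eta_2-\frac{\langle\eta_2,\eta_1\rangle}{\langle\eta_1,\eta_1\rangle}\,\eta_1\in\mathcal T_1^\perp .$$ Then the following hold. (1) $$\operatorname{Var}_\theta[T]=\big\|\operatorname{Proj}_{\mathcal T_1}\widetilde Z_0\big\|^2+\|R_1\|^2\ \ge\ \frac1{\mathcal I(\theta)},\qquad\text{and specifically}\qquad \big\|\operatorname{Proj}_{\mathcal T_1}\widetilde Z_0\big\|^2=\frac1{\mathcal I(\theta)} .$$ (2) $$\|R_1\|^2\ \ge\ \frac{\big\langle\widetilde Z_0,\mathrm{II}(\eta_1,\eta_1)\big\rangle^2}{\big\|\mathrm{II}(\eta_1,\eta_1)\big\|^2},$$ with equality if and only if $R_1$ is collinear in $L^2(\mu)$ with $\mathrm{II}(\eta_1,\eta_1)$. In particular, $$\operatorname{Var}_\theta[T]=\|\widetilde Z_0\|^2\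 \ge\ \frac1{\mathcal I(\theta)}+\frac{\big\langle\widetilde Z_0,\mathrm{II}(\eta_1,\eta_1)\big\rangle^2}{\big\|\mathrm{II}(\eta_1,\eta_1)\big\|^2}.$$
   Context: Setting. $\{P_\theta:\theta\in\Theta\subset\mathbb R\}$ is a smooth parametric family of probability measures on a measurable space, each having a strictly positive density $f(\cdot;\theta)$ with respect to a fixed base measure $\mu$. $L^2(\mu)$ is the real Hilbert space with $\langle u,v\rangle=\int uv\,d\mu$ and norm $\|\cdot\|$; $\operatorname{Proj}_V$ is orthogonal projection onto a subspace $V$. $\mathbb E_\theta$ and $\operatorname{Var}_\theta$ denote expectation and variance under $P_\theta$. Write $s_\theta:=\sqrt{f(\cdot;\theta)}\in L^2(\mu)$ (so $\|s_\theta\|=1$), $\eta_k:=\eta_k(\theta):=\partial_\theta^k s_\theta$ and $Y_k:=Y_k(\cdot;\theta):=\partial_\theta^k\log f(\cdot;\theta)$ for $k\ge1$. Standing assumptions. The derivatives $\eta_k(\theta)$, $k\ge1$, exist in the Fréchet sense in $L^2(\mu)$ and are linearly independent. The log-density is differentiable in $\theta$ and the $L^2(\mu)$-derivatives agree with the pointwise ones, so that $\eta_1=\tfrac12Y_1s_\theta$ and $\eta_2=\big(\tfrac14Y_1^2+\tfrac12Y_2\big)s_\theta$. Differentiation under the integral sign is permitted: for a statistic $T$ with $\mathbb E_\theta[T]$ finite, $\frac{\partial}{\partial\theta}\int T(x)f(x;\theta)\,d\mu=\int T(x)\frac{\partial f(x;\theta)}{\partial\theta}\,d\mu$ whenever the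 right-hand side is finite. The estimator $T$ has finite variance under $P_\theta$, so that $\widetilde Z_0\in L^2(\mu)$. *)

(* Defs.v *)
From HB Require Import structures.
From mathcomp Require Import all_boot all_order all_algebra.
From mathcomp Require Import all_classical all_reals all_analysis.

Set Implicit Arguments.
Unset Strict Implicit.
Unset Printing Implicit Defensive.

Import Order.TTheory GRing.Theory Num.Theory.
Import numFieldNormedType.Exports.

Local Open Scope classical_set_scope.
Local Open Scope ring_scope.

(* Elements of L^2(mu) are represented by functions u : X -> R such that
   u \in Lfun mu 2; equality in L^2(mu) is u = v %[ae mu].  The statements
   below do not depend on the choice of representatives. *)

Definition L2norm {d : measure_display} {X : measurableType d} {R : realType}
    (mu : {measure set X -> \bar R}) (u : X -> R) : R :=
  fine ('N[mu]_2%:E[EFin \o u])%E.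

Definition L2dot {d : measure_display} {X : measurableType d} {R : realType}
    (mu : {measure set X -> \bar R}) (u v : X -> R) : R :=
  \int[mu]_x (u x * v x).

Definition L2orth {d : measure_display} {X : measurableType d} {R : realType}
    (mu : {measure set X -> \bar R}) (V : set (X -> R)) : set (X -> R) :=
  [set u | u \in Lfun mu 2%:E /\ forall v, V v -> L2dot mu u v = 0].

(* Proj_V u, the p in V such that u - p is orthogonal to V; this determines p
   up to mu-almost everywhere equality.  The value is 0 if there is no such p,
   which does not happen when V is finite-dimensional. *)
Definition L2proj {d : measure_display} {X : measurableType d} {R : realType}
    (mu : {measure set X -> \bar R}) (V : set (X -> R)) (u : X -> R) : X -> R :=
  xget (cst 0) [set p | V p /\ L2orth mu V (u - p)].

Definition span1 {X : Type} {R : realType} (v : X -> R) : set (X -> R) :=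
  [set c *: v | c in [set: R]].

Definition L2collinear {d : measure_display} {X : measurableType d}
    {R : realType} (mu : {measure set X -> \bar R}) (u v : X -> R) : Prop :=
  exists a b : R,
    (a != 0 \/ b != 0) /\ a *: u + b *: v = (0 : X -> R) %[ae mu].

Definition L2free {d : measure_display} {X : measurableType d} {R : realType}
    (mu : {measure set X -> \bar R}) (u : nat -> X -> R) : Prop :=
  forall (n : nat) (a : 'I_n -> R),
    \sum_(i < n) a i *: u i = (0 : X -> R) %[ae mu] -> forall i, a i = 0.

(* v is the Frechet derivative at t of the curve u with values in L^2(mu):
   || u (t + h) - u t - h v || = o(h).  The first clause ensures that the
   norm is that of an element of L^2(mu) for small h. *)
Definition is_L2derive {d : measure_display} {X : measurableType d}
    {R : realType} (mu : {measure set X -> \bar R}) (u : R -> X -> R) (t : R)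
    (v : X -> R) : Prop :=
  [/\ \forall r \near t, u r \in Lfun mu 2%:E,
      v \in Lfun mu 2%:E &
      `|h|^-1 * L2norm mu (u (t + h) - u t - h *: v) @[h --> 0^'] --> (0 : R)].

Definition L2derivable {d : measure_display} {X : measurableType d}
    {R : realType} (mu : {measure set X -> \bar R}) (u : R -> X -> R) (t : R)
    : Prop :=
  exists v, is_L2derive mu u t v.

(* A representative of the L^2(mu)-derivative, chosen independently at each
   parameter value; it is the junk value 0 where the derivative does not
   exist. *)
Definition L2derive {d : measure_display} {X : measurableType d} {R : realType}
    (mu : {measure set X -> \bar R}) (u : R -> X -> R) : R -> X -> R :=
  fun t => xget (cst 0) [set v | is_L2derive mu u t v].

Definition sqrt_density {X : Type} {R : realType} (f : R -> X -> R)
    : R -> X -> R :=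
  fun t x => Num.sqrt (f t x).

(* The k-th derivative in the parameter of the square-root density, as a curve
   in L^2(mu); k = 0 gives the square-root density itself. *)
Definition eta_ {d : measure_display} {X : measurableType d} {R : realType}
    (mu : {measure set X -> \bar R}) (f : R -> X -> R) (k : nat)
    : R -> X -> R :=
  iter k (L2derive mu) (sqrt_density f).

Definition logder {X : Type} {R : realType}
    (f : R -> X -> R) (k : nat) (t : R) (x : X) : R :=
  derive1n k (fun r => ln (f r x)) t.

(* The model is indexed by Theta, and P and f are irrelevant outside Theta.
   Derivatives in the parameter are taken at the interior points of Theta. *)
Record regular_model {d : measure_display} {X : measurableType d}
    {R : realType} (mu : {measure set X -> \bar R}) (Theta : set R)
    (f : R -> X -> R) (P : R -> probability X R) : Prop := RegularModel {
  density_measurable :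
    forall t, Theta t -> measurable_fun [set: X] (f t);
  density_gt0 :
    forall t x, Theta t -> 0 < f t x;
  densityP :
    forall t A, Theta t -> measurable A ->
      P t A = (\int[mu]_(x in A) (f t x)%:E)%E;
  eta_exist :
    forall k t, Theta° t -> L2derivable mu (eta_ mu f k) t;
  eta_free :
    forall t, Theta° t -> L2free mu (fun k => eta_ mu f k.+1 t);
  (* Smoothness of the log-density in the parameter: every logder f k with
     k >= 1 is a genuine derivative. *)
  log_density_derivable :
    forall k x t, Theta° t -> derivable (logder f k ^~ x) t 1;
  (* For k = 1, 2 this amounts to eta_1 = Y_1 s / 2 and
     eta_2 = (Y_1 ^ 2 / 4 + Y_2 / 2) s, with s the square-root density and
     Y_k = logder f k. *)
  eta_pointwise :
    forall k t, Theta° t ->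
      eta_ mu f k t = (fun x => derive1n k (sqrt_density f ^~ x) t) %[ae mu];
  (* E_r[T] has to be finite for r close to t for the derivative at t of
     r |-> \int T f(.; r) dmu to be meaningful. *)
  derive_under_integral :
    forall (T : {mfun X >-> R}) t, Theta° t ->
      (\forall r \near t, (P r).-integrable [set: X] (EFin \o T)) ->
      mu.-integrable [set: X] (fun x => (T x * derive1 (f ^~ x) t)%:E) ->
      is_derive t 1 (fun r => \int[mu]_x (T x * f r x))
        (\int[mu]_x (T x * derive1 (f ^~ x) t))
}.

Definition unbiased_near {d : measure_display} {X : measurableType d}
    {R : realType} (P : R -> probability X R) (T : X -> R) (theta : R) : Prop :=
  \forall t \near theta,
    (P t).-integrable [set: X] (EFin \o T) /\ ('E_(P t)[T] = t%:E)%E.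

(* Extended-real valued, so that no finiteness is presupposed; its inverse is
   that of \bar R, with 0^-1 = +oo and +oo^-1 = 0. *)
Definition fisher_information {d : measure_display} {X : measurableType d}
    {R : realType} (f : R -> X -> R) (P : R -> probability X R) (t : R)
    : \bar R :=
  'E_(P t)[(fun x => logder f 1 t x ^+ 2)].

(* II(eta_1, eta_1): the component of eta_2 orthogonal to eta_1. *)
Definition second_fundamental_form {d : measure_display}
    {X : measurableType d} {R : realType} (mu : {measure set X -> \bar R})
    (f : R -> X -> R) (t : R) : X -> R :=
  let eta1 := eta_ mu f 1 t in
  let eta2 := eta_ mu f 2 t in
  eta2 - (L2dot mu eta2 eta1 / L2dot mu eta1 eta1) *: eta1.

(* Main.v *)
(* Write s for the square-root density.  Since the log-density is
   differentiable, eta_1 = Y_1 s / 2 almost everywhere, so I = 4 |eta_1|^2.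
   Differentiating E_r[T] = r and E_r[1] = 1 under the integral sign gives
   <Z, eta_1> = 1/2, hence the projection of Z on the line of eta_1 has
   squared norm (1/4) / |eta_1|^2 = 1/I.  The second part is Cauchy-Schwarz
   for R_1 and II, as <R_1, II> = <Z, II> by orthogonality of II and eta_1. *)

Require Import Defs.
From HB Require Import structures.
From mathcomp Require Import all_boot all_order all_algebra.
From mathcomp Require Import all_classical all_reals all_analysis.
From mathcomp Require Import measurable_realfun ring.

Set Implicit Arguments.
Unset Strict Implicit.
Unset Printing Implicit Defensive.

Import Order.TTheory GRing.Theory Num.Theory.
Import numFieldNormedType.Exports.

Local Open Scope classical_set_scope.
Local Open Scope ring_scope.

(** * Inner-product geometry of square-integrable functions *)

Section L2_geometry.
Context {d : measure_display} {X : measurableType d} {R : realType}.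
Variable mu : {measure set X -> \bar R}.
Local Notation L2 := (Lfun mu 2%:E).
Implicit Types (u v w : X -> R) (a : R).

Lemma Lfun2_measurable u : u \in L2 -> measurable_fun [set: X] u.
Proof. by move=> /andP[/[!inE]]. Qed.

Lemma Lfun2Z a u : u \in L2 -> a *: u \in L2.
Proof.
have <- : a \o* u = a *: u by apply/funext => x /=; rewrite mulrC.
by apply: Lfun_scale; rewrite ler1n.
Qed.

Lemma Lfun2B u v : u \in L2 -> v \in L2 -> u - v \in L2.
Proof. by move=> ? ?; rewrite rpredB// lee1n. Qed.

Lemma integrable_L2mul u v : u \in L2 -> v \in L2 ->
  mu.-integrable [set: X] (EFin \o (fun x => u x * v x)).
Proof. by move=> uL2 vL2; exact/Lfun1_integrable/Lfun2_mul_Lfun1. Qed.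

Lemma L2dotC u v : L2dot mu u v = L2dot mu v u.
Proof. by apply: eq_Rintegral => x _; rewrite mulrC. Qed.

Lemma L2dotZl a u v : u \in L2 -> v \in L2 ->
  L2dot mu (a *: u) v = a * L2dot mu u v.
Proof.
move=> uL2 vL2; rewrite -RintegralZl//; last exact: integrable_L2mul.
by apply: eq_Rintegral => x _; rewrite mulrA.
Qed.

Lemma L2dotZr a u v : u \in L2 -> v \in L2 ->
  L2dot mu u (a *: v) = a * L2dot mu u v.
Proof. by move=> uL2 vL2; rewrite L2dotC L2dotZl// L2dotC. Qed.

Lemma L2dotBl u v w : u \in L2 -> v \in L2 -> w \in L2 ->
  L2dot mu (u - v) w = L2dot mu u w - L2dot mu v w.
Proof.
move=> uL2 vL2 wL2; rewrite -RintegralB//; [|exact: integrable_L2mul..].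
by apply: eq_Rintegral => x _; rewrite mulrBl.
Qed.

Lemma L2dotBr u v w : u \in L2 -> v \in L2 -> w \in L2 ->
  L2dot mu w (u - v) = L2dot mu w u - L2dot mu w v.
Proof. by move=> uL2 vL2 wL2; rewrite L2dotC L2dotBl// !(L2dotC w). Qed.

Lemma EFin_L2dot u v : u \in L2 -> v \in L2 ->
  (L2dot mu u v)%:E = (\int[mu]_x (u x * v x)%:E)%E.
Proof.
move=> uL2 vL2; rewrite fineK// integrable_fin_num//.
exact: integrable_L2mul.
Qed.

(** Independence of representatives: [eta_] is known only almost everywhere, so its inner products
    are computed after replacing it by an explicit function. *)
Lemma ae_eq_L2dot u u' v v' : u \in L2 -> u' \in L2 -> v \in L2 -> v' \in L2 ->
  u = u' %[ae mu] -> v = v' %[ae mu] -> L2dot mu u v = L2dot mu u' v'.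
Proof.
move=> uL2 u'L2 vL2 v'L2 uu' vv'; congr fine.
apply: ae_eq_integral => //.
- by apply/measurable_EFinP; apply: measurable_funM; exact: Lfun2_measurable.
- by apply/measurable_EFinP; apply: measurable_funM; exact: Lfun2_measurable.
- by apply: filterS2 uu' vv' => x uE vE Dx; rewrite uE// vE.
Qed.

(** [L2norm] is the [fine] of an extended norm; membership in L^2 makes that norm finite, so [fine]
    loses nothing. *)
Lemma sqr_L2norm u : u \in L2 -> L2norm mu u ^+ 2 = L2dot mu u u.
Proof.
move=> uL2; rewrite -powR_mulrn ?fine_ge0 ?Lnorm_ge0//.
apply/EFin_inj; rewrite EFin_L2dot// -poweR_EFin fineK; last first.
  rewrite ge0_fin_numE ?Lnorm_ge0//.
  by move: uL2 => /andP[_ /[!inE]].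
rewrite poweR_Lnorm//; apply: eq_integral => x _.
by rewrite /= powR_mulrn// real_normK ?num_real.
Qed.

Lemma L2dot_ge0 u : 0 <= L2dot mu u u.
Proof. by apply: Rintegral_ge0 => x _; rewrite -expr2 sqr_ge0. Qed.

(** A nonnegative integrand with zero integral vanishes almost everywhere. *)
Lemma L2dot_eq0 u : u \in L2 ->
  L2dot mu u u = 0 <-> u = (0 : X -> R) %[ae mu].
Proof.
move=> uL2; split=> [u0|u0]; last first.
  have zL2 : (0 : X -> R) \in L2 by rewrite -(scale0r u); exact: Lfun2Z.
  rewrite (ae_eq_L2dot uL2 zL2 uL2 zL2 u0 u0) -[in LHS](scale0r (0 : X -> R)).
  by rewrite L2dotZl ?mul0r//; exact: Lfun2Z.
have mu2 : measurable_fun [set: X] (EFin \o (fun x => u x * u x)).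
  by apply/measurable_EFinP; apply: measurable_funM; exact: Lfun2_measurable.
have : (\int[mu]_x `|(u x * u x)%:E|)%E = 0%E.
  rewrite -[RHS]/(0%:E) -[in RHS]u0 EFin_L2dot//.
  by apply: eq_integral => x _; rewrite gee0_abs// lee_fin -expr2 sqr_ge0.
move=> /(ae_eq_integral_abs mu measurableT mu2).
apply: filterS => x /[apply] /= -[] /eqP; rewrite mulf_eq0 orbb => /eqP ->.
by [].
Qed.

(** Orthogonality to [v] determines the coefficient, as [v] has nonzero norm. The element picked by
    [xget] is therefore this very function, not merely one equal to it almost everywhere. *)
Lemma L2proj_span1 u v : u \in L2 -> v \in L2 -> L2dot mu v v != 0 ->
  L2proj mu (span1 v) u = (L2dot mu u v / L2dot mu v v) *: v.
Proof.
move=> uL2 vL2 v0.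
have orthE a : L2orth mu (span1 v) (u - a *: v) <->
    a = L2dot mu u v / L2dot mu v v.
  have avL2 := Lfun2Z a vL2.
  split.
    case=> _ /(_ v); rewrite L2dotBl// L2dotZl// => H.
    have /eqP : L2dot mu u v - a * L2dot mu v v = 0.
      by apply: H; exists 1; rewrite ?scale1r.
    by rewrite subr_eq0 => /eqP ->; rewrite mulfK.
  move=> ->; split; first by apply: Lfun2B => //; exact: Lfun2Z.
  move=> _ [b _ <-].
  rewrite L2dotBl ?L2dotZl ?L2dotZr//; [|exact: Lfun2Z..].
  by field.
rewrite /L2proj; case: xgetP => [p _ [[a _ <-] /orthE ->//]|].
move=> /(_ ((L2dot mu u v / L2dot mu v v) *: v)).
by case; split; [exists (L2dot mu u v / L2dot mu v v)|exact/orthE].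
Qed.

Lemma L2orth_span1 u v : u \in L2 -> v \in L2 -> L2dot mu u v = 0 ->
  L2orth mu (span1 v) u.
Proof.
by move=> uL2 vL2 uv; split=> // _ [a _ <-]; rewrite L2dotZr// uv mulr0.
Qed.

(** This one expansion of a square serves twice: for Cauchy-Schwarz with its equality case, and for
    the Pythagorean split of the variance. *)
Lemma L2dot_residual u v : u \in L2 -> v \in L2 -> L2dot mu v v != 0 ->
  let r := u - (L2dot mu u v / L2dot mu v v) *: v in
  L2dot mu r r = L2dot mu u u - L2dot mu u v ^+ 2 / L2dot mu v v.
Proof.
move=> uL2 vL2 v0 /=; set a := _ / _.
have avL2 : a *: v \in L2 by exact: Lfun2Z.
rewrite L2dotBl ?L2dotBr ?L2dotZl ?L2dotZr ?(L2dotC v u)//; last exact: Lfun2B.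
by rewrite /a; field.
Qed.

(** The gap between the two sides is the squared norm of the residual. *)
Lemma L2_cauchy_schwarz u v : u \in L2 -> v \in L2 -> L2dot mu v v != 0 ->
  L2dot mu u v ^+ 2 / L2dot mu v v <= L2dot mu u u.
Proof.
by move=> uL2 vL2 v0; rewrite -subr_ge0 -L2dot_residual// L2dot_ge0.
Qed.

(** Equality makes the residual [u - a *: v] vanish almost everywhere, which is a collinearity
    relation with coefficients [1] and [- a]. *)
Lemma L2_cauchy_schwarz_eq u v : u \in L2 -> v \in L2 -> L2dot mu v v != 0 ->
  L2dot mu u u = L2dot mu u v ^+ 2 / L2dot mu v v <-> L2collinear mu u v.
Proof.
move=> uL2 vL2 v0; set a := L2dot mu u v / L2dot mu v v.
have avL2 := Lfun2Z a vL2.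
split=> [uv|[b [c [bc0 bcuv]]]].
  exists 1, (- a); split; first by left; exact: oner_neq0.
  rewrite scale1r scaleNr; apply/L2dot_eq0; first exact: Lfun2B.
  by rewrite L2dot_residual// uv subrr.
(* If [b] were 0, then [c] would be nonzero and [c *: v] zero almost everywhere, against [v0]. Hence
   the relation can be solved for [u]. *)
have b0 : b != 0.
  apply: contra_not_neq (negP v0) => b0; apply/eqP/L2dot_eq0 => //.
  move: bc0 bcuv; rewrite b0 eqxx scale0r add0r => -[//|c0].
  apply: filterS => x /[apply] /eqP; rewrite [_ == _]mulf_eq0 (negbTE c0).
  by move=> /eqP.
have uE : u = (- (c / b)) *: v %[ae mu].
  have solve y z : b * y + c * z = 0 -> y = - (c / b) * z.
    move=> /eqP; rewrite addr_eq0 => /eqP E.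
    by apply: (mulfI b0); rewrite E; field.
  by apply: filterS bcuv => x /[apply]; exact: solve.
have cvL2 := Lfun2Z (- (c / b)) vL2.
rewrite (ae_eq_L2dot uL2 cvL2 uL2 cvL2 uE uE).
rewrite (ae_eq_L2dot uL2 cvL2 vL2 vL2 uE (ae_eq_refl _ _ _)).
rewrite !L2dotZl ?L2dotZr//.
by field; rewrite b0 v0.
Qed.

End L2_geometry.

(** * Membership in L^2 through the integral of the square *)

Section Lfun2_criterion.
Context {d : measure_display} {X : measurableType d} {R : realType}.
Variable mu : {measure set X -> \bar R}.
Local Notation L2 := (Lfun mu 2%:E).
Implicit Types u v : X -> R.

Lemma Lfun2P u : u \in L2 <->
  measurable_fun [set: X] u /\ (\int[mu]_x (u x ^+ 2)%:E < +oo)%E.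
Proof.
have normE : (\int[mu]_x (`|(EFin \o u) x| `^ 2) = \int[mu]_x (u x ^+ 2)%:E)%E.
  by apply: eq_integral => x _; rewrite /= powR_mulrn// real_normK ?num_real.
split=> [uL2|[mu_ uoo]].
  split; first exact: Lfun2_measurable uL2.
  move: (uL2) => /andP[_ /[!inE]/= /(poweR_lty 2)].
  by rewrite poweR_Lnorm// normE.
apply/andP; split; rewrite inE//= /finite_norm unlock.
by apply: poweR_lty; rewrite normE.
Qed.

(** Measurability of [v] is assumed because [mu] need not be complete: almost everywhere equality
    alone does not transfer it. *)
Lemma ae_eq_Lfun2 u v : measurable_fun [set: X] v -> u = v %[ae mu] ->
  u \in L2 -> v \in L2.
Proof.
move=> mv uv /Lfun2P[mu_ uoo]; apply/Lfun2P; split=> //.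
rewrite (ae_eq_integral (fun x => (u x ^+ 2)%:E))//.
- by apply/measurable_EFinP; exact: measurable_funX.
- by apply/measurable_EFinP; exact: measurable_funX.
- by apply: filterS uv => x /[apply] ->.
Qed.

End Lfun2_criterion.

(** * Integration against a measure given by a density *)

Section density.
Context {d : measure_display} {X : measurableType d} {R : realType}.
Variables (mu nu : {measure set X -> \bar R}) (g : X -> R).
Hypothesis g0 : forall x, 0 <= g x.
Hypothesis mg : measurable_fun [set: X] g.
Hypothesis nuE :
  forall A, measurable A -> nu A = (\int[mu]_(x in A) (g x)%:E)%E.
Local Open Scope ereal_scope.
Import HBNNSimple.

(** The two sides agree on indicators by [nuE], on simple functions by linearity, and in general by
    monotone convergence along [nnsfun_approx]. *)
Lemma ge0_integral_density (h : X -> \bar R) :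
  (forall x, 0 <= h x) -> measurable_fun [set: X] h ->
  \int[nu]_x h x = \int[mu]_x (h x * (g x)%:E).
Proof.
move=> h0 mh; pose k := nnsfun_approx measurableT mh.
have mgE : measurable_fun [set: X] (EFin \o g) by exact/measurable_EFinP.
have mk n : measurable_fun [set: X] (EFin \o k n) by exact/measurable_EFinP.
have hE x : h x = lim ((EFin \o k n) x @[n --> \oo]).
  by apply/esym/cvg_lim => //; exact: cvg_nnsfun_approx.
have kg n : \int[mu]_x ((k n x)%:E * (g x)%:E) = \int[nu]_x (k n x)%:E.
  transitivity (\int[mu]_x (\sum_(y \in range (k n))
      (y * \1_(k n @^-1` [set y]) x)%:E * (g x)%:E)).
    apply: eq_integral => x _.
    rewrite -ge0_mule_fsuml => [|y]; last exact: nnfun_muleindic_ge0.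
    by rewrite fsumEFin// -(fimfunE _ x).
  transitivity (\int[nu]_x (\sum_(y \in range (k n))
      (y * \1_(k n @^-1` [set y]) x)%:E)); last first.
    by apply: eq_integral => x _; rewrite /= fimfunE -fsumEFin.
  have mind y : measurable_fun [set: X]
      (fun x => (y * \1_(k n @^-1` [set y]) x)%:E).
    by apply/measurable_EFinP; exact: measurable_funM.
  rewrite !ge0_integral_fsum//; last 3 first.
  - by move=> y x _; exact: nnfun_muleindic_ge0.
  - by move=> y; exact: emeasurable_funM.
  - by move=> y x _; rewrite mule_ge0 ?lee_fin//; exact: nnfun_muleindic_ge0.
  apply: eq_fsbigr => r rk.
  under [RHS]eq_integral do rewrite EFinM.
  rewrite integralZl_indic_nnsfun => //.
  under eq_integral do rewrite EFinM -muleA.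
  rewrite ge0_integralZl//.
  - under eq_integral do rewrite muleC.
    rewrite (eq_integral ((EFin \o g) \_ (k n @^-1` [set r]))); last first.
      by move=> x xE; rewrite epatch_indic.
    rewrite -integral_mkcond integral_indic// setIT. by rewrite nuE.
  - by apply: emeasurable_funM => //; exact/measurable_EFinP.
  - by move=> x _; rewrite mule_ge0 ?lee_fin.
  - by move: rk; rewrite inE => -[x _ <-]; rewrite lee_fin.
transitivity (lim (\int[nu]_x (EFin \o k n) x @[n --> \oo])).
  under eq_integral do rewrite hE.
  apply: monotone_convergence => //.
  - by move=> n x _; rewrite lee_fin.
  - by move=> x _ a b ab; rewrite lee_fin; exact/lefP/nd_nnsfun_approx.
under eq_fun do rewrite -kg.
have hgE x : h x * (g x)%:E = lim ((k n x)%:E * (g x)%:E @[n --> \oo]).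
  apply/esym/cvg_lim => //; apply: cvgeZr => //.
  exact: cvg_nnsfun_approx.
under [RHS]eq_integral do rewrite hgE.
apply/esym/monotone_convergence => //.
- by move=> n; exact: emeasurable_funM (mk n) mgE.
- by move=> n x _; rewrite mule_ge0 ?lee_fin.
- move=> x _ a b ab; rewrite lee_wpmul2r ?lee_fin//.
  exact/lefP/nd_nnsfun_approx.
Qed.

(** Since [g] is nonnegative, [|h| g = |h g|], and the nonnegative case compares the integrals of
    the absolute values. *)
Lemma integrable_density (h : X -> R) : measurable_fun [set: X] h ->
  nu.-integrable [set: X] (EFin \o h) <->
  mu.-integrable [set: X] (EFin \o (fun x => h x * g x)%R).
Proof.
move=> mh; have mhg : measurable_fun [set: X] (fun x => h x * g x)%R.
  exact: measurable_funM.
have absE : \int[nu]_x `|(h x)%:E| = \int[mu]_x `|(h x * g x)%:E|.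
  rewrite ge0_integral_density//.
    apply: eq_integral => x _.
    by rewrite EFinM abseM (@gee0_abs _ (g x)%:E) ?lee_fin.
  by apply: measurableT_comp => //; exact/measurable_EFinP.
split=> /integrableP[_ hoo]; apply/integrableP; split;
  by [exact/measurable_EFinP|rewrite /= ?absE// -absE].
Qed.

(** Positive and negative parts are handled separately; multiplication by the nonnegative [g]
    commutes with taking either part. *)
Lemma Rintegral_density (h : X -> R) :
  nu.-integrable [set: X] (EFin \o h) ->
  (\int[nu]_x h x = \int[mu]_x (h x * g x))%R.
Proof.
move=> ih; have mh : measurable_fun [set: X] h.
  by apply/measurable_EFinP; exact: measurable_int ih.
have ihg : mu.-integrable [set: X] (EFin \o (fun x => h x * g x)%R).
  exact/integrable_density.
congr fine; rewrite integralE [in RHS]integralE; congr (_ - _).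
- rewrite ge0_integral_density//; last first.
    by apply: measurable_funepos; exact/measurable_EFinP.
  apply: eq_integral => x _; rewrite !funeposE/= -!EFin_max.
  by rewrite -EFinM maxr_pMl// mul0r.
- rewrite ge0_integral_density//; last first.
    by apply: measurable_funeneg; exact/measurable_EFinP.
  apply: eq_integral => x _; rewrite !funenegE/= -!EFin_max.
  by rewrite -EFinM maxr_pMl// mul0r mulNr.
Qed.

End density.

(** * Derivatives in the parameter recovered from the logarithm *)

Section parameter_derivative.
Context {R : realType}.
Implicit Types (g : R -> R) (t : R).

(** Near [t], [g] is the exponential of its logarithm, so the chain rule applies. *)
Lemma is_derive_ln_inv g t : (\forall r \near t, 0 < g r) ->
  derivable (fun r => ln (g r)) t 1 ->
  is_derive t 1 g (g t * derive1 (fun r => ln (g r)) t).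
Proof.
move=> g_gt0 dlng.
have gE : \near t, (expR \o (fun r => ln (g r))) t = g t.
  by apply: filterS g_gt0 => r; exact: lnK.
apply: near_eq_is_derive gE _.
have := nbhs_singleton g_gt0 => gt0.
rewrite -[X in X * _]lnK ?posrE// derive1E.
exact: (@is_derive1_comp _ expR (fun r => ln (g r))).
Qed.

(** Near [t], the square root is the exponential of half the logarithm; this is where the factor
    [2^-1] comes from. *)
Lemma is_derive_sqrt_ln g t : (\forall r \near t, 0 < g r) ->
  derivable (fun r => ln (g r)) t 1 ->
  is_derive t 1 (fun r => Num.sqrt (g r))
    (2^-1 * derive1 (fun r => ln (g r)) t * Num.sqrt (g t)).
Proof.
move=> g_gt0 dlng.
(* Both sides are nonnegative and have square [g r]. *)
have sE r : 0 < g r -> expR (2^-1 * ln (g r)) = Num.sqrt (g r).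
  move=> gr; apply: (@pexpIrn _ 2) => //.
  - by rewrite nnegrE expR_ge0.
  - by rewrite nnegrE sqrtr_ge0.
  by rewrite sqr_sqrtr ?ltW// -expRM_natl mulVKf ?lnK// lt0r_neq0.
have gE : \near t, (expR \o (fun r => 2^-1 * ln (g r))) t = Num.sqrt (g t).
  by apply: filterS g_gt0 => r; exact: sE.
apply: near_eq_is_derive gE _.
rewrite mulrC -(sE _ (nbhs_singleton g_gt0)).
apply: (@is_derive1_comp _ expR); rewrite derive1E.
exact: is_deriveZ.
Qed.

(** The derivative is the pointwise limit of difference quotients along a single sequence of steps,
    and such a limit of measurable functions is measurable. *)
Lemma measurable_derive1 {d : measure_display} {X : measurableType d}
    (f : R -> X -> R) t :
  (\forall r \near t, measurable_fun [set: X] (f r)) ->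
  (forall x, derivable (f ^~ x) t 1) ->
  measurable_fun [set: X] (fun x => derive1 (f ^~ x) t).
Proof.
move=> /nbhs_ballP[e /= e0 mf] df.
(* Dividing by [n.+2] keeps every step strictly below [e], inside the open ball where [f r] is
   measurable; with [n.+1] the first step would be [e] itself. *)
pose h n : R := e / n.+2%:R.
have h0 n : h n != 0 by rewrite mulf_neq0 ?gt_eqF// invr_gt0.
have hcvg : h @ \oo --> (0 : R).
  rewrite -[0](mulr0 e); apply: cvgM; first exact: cvg_cst.
  have := @cvg_harmonic R; rewrite -(cvg_shiftS (@harmonic R)).
  exact.
apply: (@measurable_fun_cvg _ _ _ _
  (fun n x => (h n)^-1 * (f (h n + t) x - f t x))).
  move=> n; apply: measurable_funM => //; apply: measurable_funB; apply: mf.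
    rewrite /ball/= opprD addrCA subrr addr0 normrN gtr0_norm ?divr_gt0//.
    by rewrite ltr_pdivrMr// ltr_pMr// ltr1n.
  exact: ballxx.
move=> x _; have := df x => /cvg_ex[l] dl.
(* [derivable] writes the increment as [y *: 1]; [mulr1] turns it into the ordinary difference
   quotient. *)
have -> : derive1 (f ^~ x) t = l.
  rewrite /derive1; apply/cvg_lim => //; apply: cvg_trans dl.
  by apply: near_eq_cvg; apply: nearW => y; rewrite /= [y%:A]mulr1.
have /cvgr_dnbhsP/(_ h) : h^-1 *: (f (h + t) x - f t x) @[h --> 0^'] --> l.
  apply: cvg_trans dl.
  by apply: near_eq_cvg; apply: nearW => y; rewrite /= [y%:A]mulr1.
by apply; split.
Qed.

End parameter_derivative.

(** * Score, Fisher information and [eta_] at an interior parameter *)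

Section regular_model_theory.
Context {R : realType} {d : measure_display} {X : measurableType d}.
Variables (mu : {measure set X -> \bar R}) (Theta : set R) (f : R -> X -> R).
Variables (P : R -> probability X R) (theta : R).
Hypothesis model : regular_model mu Theta f P.
Hypothesis theta_int : Theta° theta.
Local Notation L2 := (Lfun mu 2%:E).
Local Notation s := (sqrt_density f theta).
Local Notation eta1 := (eta_ mu f 1 theta).
Local Notation eta2 := (eta_ mu f 2 theta).
Local Notation Y := (logder f 1 theta).
Local Notation df := (fun x => derive1 (f ^~ x) theta).

Let near_Theta : \forall r \near theta, Theta r.
Proof. exact: theta_int. Qed.

Let theta_Theta : Theta theta.
Proof. exact: nbhs_singleton near_Theta. Qed.

Let f_ge0 r : Theta r -> forall x, 0 <= f r x.
Proof. by move=> Tr x; rewrite ltW// (density_gt0 model). Qed.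

Let near_f_gt0 x : \forall r \near theta, 0 < f r x.
Proof.
by apply: filterS near_Theta => r Tr; exact: density_gt0 model _ _ Tr.
Qed.

(** Index 0 of [logder] is the log-density itself. *)
Let ln_derivable x : derivable (fun r => ln (f r x)) theta 1.
Proof. exact: log_density_derivable model 0%N x theta theta_int. Qed.

(** Existence of a derivative makes [xget] return a genuine one rather than the default, and
    [is_L2derive] includes membership in L^2. *)
Lemma eta_L2 k : eta_ mu f k.+1 theta \in L2.
Proof.
have [v vP] := eta_exist model k theta_int.
have : is_L2derive mu (eta_ mu f k) theta (eta_ mu f k.+1 theta).
  exact: (xgetI (cst 0) vP).
by case.
Qed.

Lemma sqr_sqrt_density x : s x ^+ 2 = f theta x.
Proof. by rewrite sqr_sqrtr// f_ge0. Qed.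

Lemma measurable_sqrt_density : measurable_fun [set: X] s.
Proof.
apply: measurableT_comp; last exact: density_measurable model _ theta_Theta.
exact: continuous_measurable_fun (@sqrt_continuous R).
Qed.

Lemma sqrt_density_L2 : s \in L2.
Proof.
apply/Lfun2P; split; first exact: measurable_sqrt_density.
under eq_integral do rewrite sqr_sqrt_density.
by rewrite -(densityP model)// probability_setT ltry.
Qed.

Lemma derive1_density x : df x = f theta x * Y x.
Proof.
have := is_derive_ln_inv (near_f_gt0 x) (@ln_derivable x).
by move=> /@derive_val; rewrite -derive1E.
Qed.

Lemma measurable_score : measurable_fun [set: X] Y.
Proof.
apply: (@measurable_derive1 _ _ _ (fun r x => ln (f r x))) => //.
apply: filterS near_Theta => r Tr.
by apply: measurableT_comp => //; exact: density_measurable model _ Tr.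
Qed.

Lemma eta1_score : eta1 = (fun x => 2^-1 * Y x * s x) %[ae mu].
Proof.
apply: filterS (eta_pointwise model 1 theta_int) => x /[apply] ->.
have := is_derive_sqrt_ln (near_f_gt0 x) (@ln_derivable x).
by move=> /@derive_val; rewrite -derive1E.
Qed.

(** Square integrability is inherited from [eta1]; from here on this explicit representative is the
    one used in computations. *)
Lemma half_score_L2 : (fun x => 2^-1 * Y x * s x) \in L2.
Proof.
apply: ae_eq_Lfun2 eta1_score (eta_L2 0).
apply: measurable_funM measurable_sqrt_density.
exact: measurable_funM measurable_score.
Qed.

(** Twice the representative of [eta1] is [Y s], whose square [Y ^ 2 f] is the integrand of the
    information with respect to [mu]. In particular the information is finite. *)
Lemma fisher_informationE :
  fisher_information f P theta = (4 * L2dot mu eta1 eta1)%:E.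
Proof.
have hL2 := half_score_L2; have e1L2 := eta_L2 0.
have h2L2 := Lfun2Z 2 hL2.
rewrite (ae_eq_L2dot e1L2 hL2 e1L2 hL2 eta1_score eta1_score).
rewrite (_ : 4 * _ = L2dot mu (2 *: (fun x => 2^-1 * Y x * s x))
                              (2 *: (fun x => 2^-1 * Y x * s x))); last first.
  by rewrite L2dotZl// L2dotZr// mulrA -natrM.
rewrite /fisher_information unlock.
rewrite (ge0_integral_density (f_ge0 theta_Theta)
  (density_measurable model theta_Theta) (fun A => densityP model theta_Theta)).
- rewrite EFin_L2dot//; apply: eq_integral => x _.
  rewrite -EFinM -sqr_sqrt_density; congr EFin.
  have arith (a b : R) :
    a ^+ 2 * b ^+ 2 = 2 * (2^-1 * a * b) * (2 * (2^-1 * a * b)) by field.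
  exact: arith.
- by move=> x; rewrite lee_fin sqr_ge0.
- by apply/measurable_EFinP; apply: measurable_funX; exact: measurable_score.
Qed.

(** The mean function [phi] is left general because two instances are needed: the estimator with the
    identity, and the constant statistic 1 with a constant mean. *)
Lemma L2dot_eta1 (S : {mfun X >-> R}) (phi : R -> R) (c : R) :
  (\forall r \near theta, (P r).-integrable [set: X] (EFin \o S) /\
    ('E_(P r)[S] = (phi r)%:E)%E) ->
  is_derive theta 1 phi c -> (fun x => S x * s x) \in L2 ->
  L2dot mu (fun x => S x * s x) eta1 = 2^-1 * c.
Proof.
move=> Sphi dphi SsL2.
have hL2 := half_score_L2; have e1L2 := eta_L2 0.
rewrite (ae_eq_L2dot SsL2 SsL2 e1L2 hL2 (ae_eq_refl _ _ _) eta1_score).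
(* Writing the density as [s ^ 2] shows the integrand to be twice a product of two L^2 functions,
   hence integrable as differentiation under the integral requires. *)
have SdfE x : S x * df x = 2 * (S x * s x * (2^-1 * Y x * s x)).
  by rewrite derive1_density -sqr_sqrt_density; field.
have iS : mu.-integrable [set: X] (EFin \o
    (fun x => S x * s x * (2^-1 * Y x * s x))).
  exact: integrable_L2mul.
have iSdf : mu.-integrable [set: X] (fun x => (S x * df x)%:E).
  under eq_fun do rewrite SdfE EFinM.
  exact: integrableZl.
have Sint : \forall r \near theta, (P r).-integrable [set: X] (EFin \o S).
  by apply: filterS Sphi => r [].
have := derive_under_integral model theta_int Sint iSdf.
(* The means are prescribed only near [theta], which is enough to identify the two derivatives
   there. *)
have phiE : \forall r \near theta, phi r = \int[mu]_x (S x * f r x).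
  apply: filterS2 near_Theta Sphi => r Tr [iSr].
  rewrite unlock => Er.
  rewrite -(Rintegral_density (f_ge0 Tr)
    (density_measurable model Tr) (fun A => densityP model Tr))//.
  by rewrite /Rintegral Er.
have dint := near_eq_is_derive phiE dphi.
move=> /@derive_val; rewrite (@derive_val _ _ _ _ _ _ _ dint).
move=> ->.
under eq_Rintegral do rewrite SdfE.
by rewrite RintegralZl// mulrA mulVf// mul1r.
Qed.

(** * The deviation of a locally unbiased estimator *)

Section unbiased_estimator.
Variable T : {mfun X >-> R}.
Hypothesis T_unbiased : unbiased_near P T theta.
Hypothesis T_var : ('V_(P theta)[T] < +oo)%E.
Local Notation Z := (fun x => (T x - theta) * s x).

Lemma variance_unbiased :
  ('V_(P theta)[T] = \int[mu]_x (Z x ^+ 2)%:E)%E.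
Proof.
have [_ ET] := nbhs_singleton T_unbiased.
rewrite /variance unlock ET/= unlock.
rewrite (ge0_integral_density (f_ge0 theta_Theta)
  (density_measurable model theta_Theta) (fun A => densityP model theta_Theta)).
- apply: eq_integral => x _; rewrite -EFinM -sqr_sqrt_density; congr EFin.
  by rewrite exprMn.
- by move=> x; rewrite lee_fin -expr2 sqr_ge0.
- apply/measurable_EFinP.
  by apply: measurable_funM; exact: measurable_funB.
Qed.

Lemma deviation_L2 : Z \in L2.
Proof.
apply/Lfun2P; split; last by rewrite -variance_unbiased.
by apply: measurable_funM measurable_sqrt_density; exact: measurable_funB.
Qed.

Lemma variance_L2norm : ('V_(P theta)[T] = (L2norm mu Z ^+ 2)%:E)%E.
Proof.
rewrite sqr_L2norm ?deviation_L2// EFin_L2dot ?deviation_L2//.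
by rewrite variance_unbiased; apply: eq_integral => x _; rewrite expr2.
Qed.

(** Split [Z] as [T s - theta s]: the first term contributes half the derivative of the identity,
    and the second nothing, because the total mass is constant in the parameter. *)
Lemma L2dot_deviation_eta1 : L2dot mu Z eta1 = 2^-1.
Proof.
have sL2 := sqrt_density_L2; have tsL2 := Lfun2Z theta sL2.
(* [T s] is rebuilt from [Z] and [s], both already in L^2, so it needs no moment estimate of its
   own. *)
have TsE : (fun x => T x * s x) = Z - (- theta) *: s.
  have arith (a b c : R) : a * b = (a - c) * b - (- c) * b by ring.
  by apply/funext => x; exact: arith.
have TsL2 : (fun x => T x * s x) \in L2.
  by rewrite TsE; apply: Lfun2B deviation_L2 _; exact: Lfun2Z.
have T1 : L2dot mu (fun x => T x * s x) eta1 = 2^-1 * 1.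
  by apply: L2dot_eta1 T_unbiased _ TsL2; exact: is_derive_id.
have sE : (fun x => cst (1 : R) x * s x) = s.
  by apply/funext => x; rewrite mul1r.
have s0 : L2dot mu s eta1 = 2^-1 * 0.
  rewrite -[X in L2dot mu X]sE.
  apply: (@L2dot_eta1 (cst 1) (cst 1)).
  - apply: (@nearW _ (nbhs theta)) => r; rewrite expectation_cst; split=> //.
    exact: finite_measure_integrable_cst.
  - by rewrite /= sE.
have -> : Z = (fun x => T x * s x) - theta *: s.
  by apply/funext => x; exact: mulrBl.
rewrite L2dotBl ?L2dotZl ?T1 ?s0 ?mulr0 ?mulr1 ?subr0//; exact: eta_L2.
Qed.

End unbiased_estimator.

End regular_model_theory.

Theorem theorem2 (R : realType) (d : measure_display) (X : measurableType d)
    (mu : {measure set X -> \bar R}) (Theta : set R) (f : R -> X -> R)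
    (P : R -> probability X R) (theta : R) (T : {mfun X >-> R})
    (model : regular_model mu Theta f P) (theta_int : Theta° theta)
    (T_unbiased : unbiased_near P T theta)
    (T_var : ('V_(P theta)[T] < +oo)%E) :
  let Z := (fun x => (T x - theta) * sqrt_density f theta x) : X -> R in
  let T1 := span1 (eta_ mu f 1 theta) in
  let Z1 := L2proj mu T1 Z in
  let R1 := Z - Z1 in
  let II := second_fundamental_form mu f theta in
  let I := fisher_information f P theta in
  [/\ [/\ Z \in Lfun mu 2%:E, L2orth mu T1 R1 & L2orth mu T1 II],
      [/\ 'V_(P theta)[T] = (L2norm mu Z1 ^+ 2 + L2norm mu R1 ^+ 2)%:E,
          (I^-1 <= 'V_(P theta)[T])%E &
          (L2norm mu Z1 ^+ 2)%:E = (I^-1)%E],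
      L2dot mu Z II ^+ 2 / L2norm mu II ^+ 2 <= L2norm mu R1 ^+ 2 /\
      (L2norm mu R1 ^+ 2 = L2dot mu Z II ^+ 2 / L2norm mu II ^+ 2 <->
        L2collinear mu R1 II) &
      'V_(P theta)[T] = (L2norm mu Z ^+ 2)%:E /\
      (I^-1 + (L2dot mu Z II ^+ 2 / L2norm mu II ^+ 2)%:E
         <= 'V_(P theta)[T])%E].
Proof.
move=> Z T1 Z1 R1 II I.
pose e1 := eta_ mu f 1 theta; pose e2 := eta_ mu f 2 theta.
have e1L2 : e1 \in Lfun mu 2%:E := eta_L2 model theta_int 0.
have e2L2 : e2 \in Lfun mu 2%:E := eta_L2 model theta_int 1.
(* Independence of the first two derivatives. Coefficients [1] and [0] will show that [e1] is
   nonzero; coefficient [1] on [e2] will do the same for [II]. *)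
have free a b : a *: e1 + b *: e2 = (0 : X -> R) %[ae mu] -> a = 0 /\ b = 0.
  move=> ab0.
  have /(_ 2 (fun i : 'I_2 => if i == ord0 then a else b)) :=
    eta_free model theta_int.
  rewrite !big_ord_recl big_ord0 addr0 => /(_ ab0) H.
  by split; [exact: (H ord0)|exact: (H ord_max)].
have e10 : L2dot mu e1 e1 != 0.
  apply/eqP => /(L2dot_eq0 e1L2) e10.
  have [|/eqP] := @free 1 0; first by rewrite scale1r scale0r addr0.
  by rewrite oner_eq0.
have ZL2 : Z \in Lfun mu 2%:E := deviation_L2 model theta_int T_unbiased T_var.
have IIL2 : II \in Lfun mu 2%:E by apply: Lfun2B => //; exact: Lfun2Z.
have IIe1 : L2dot mu II e1 = 0.
  rewrite L2dotBl ?L2dotZl//; last exact: Lfun2Z.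
  by rewrite divfK// subrr.
have II0 : L2dot mu II II != 0.
  apply/eqP => /(L2dot_eq0 IIL2) II0.
  have [|_ /eqP] := @free (- (L2dot mu e2 e1 / L2dot mu e1 e1)) 1.
    by rewrite scale1r scaleNr addrC.
  by rewrite oner_eq0.
have Ze1 : L2dot mu Z e1 = 2^-1 :=
  L2dot_deviation_eta1 model theta_int T_unbiased T_var.
pose c := L2dot mu Z e1 / L2dot mu e1 e1.
have Z1E : Z1 = c *: e1 by exact: L2proj_span1.
have ce1L2 : c *: e1 \in Lfun mu 2%:E by exact: Lfun2Z.
have Z1L2 : Z1 \in Lfun mu 2%:E by rewrite Z1E.
have R1L2 : R1 \in Lfun mu 2%:E by exact: Lfun2B.
have R1e1 : L2dot mu R1 e1 = 0.
  by rewrite /R1 L2dotBl// Z1E L2dotZl// divfK// subrr.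
have R1II : L2dot mu R1 II = L2dot mu Z II.
  by rewrite /R1 L2dotBl// Z1E L2dotZl// (L2dotC _ e1) IIe1 mulr0 subr0.
have VE : 'V_(P theta)[T] = (L2norm mu Z ^+ 2)%:E :=
  variance_L2norm model theta_int T_unbiased T_var.
have normZ1 : L2norm mu Z1 ^+ 2 = (4 * L2dot mu e1 e1)^-1.
  rewrite sqr_L2norm// Z1E L2dotZl ?L2dotZr// /c Ze1.
  by field.
have IE : (I^-1)%E = (L2norm mu Z1 ^+ 2)%:E.
  (* As [e1] is nonzero, the information is a nonzero real, so its inverse in [\bar R] is the real
     inverse and not the value [+oo] taken at 0. *)
  rewrite /I (fisher_informationE model theta_int) inver normZ1.
  by rewrite ifF//; apply/negbTE; rewrite mulf_neq0.
have pyth : L2norm mu Z ^+ 2 = L2norm mu Z1 ^+ 2 + L2norm mu R1 ^+ 2.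
  have R1R1 : L2dot mu R1 R1 =
      L2dot mu Z Z - L2dot mu Z e1 ^+ 2 / L2dot mu e1 e1.
    by rewrite /R1 Z1E L2dot_residual.
  rewrite !sqr_L2norm// R1R1.
  by rewrite Z1E L2dotZl ?L2dotZr// /c; field.
have CS : L2dot mu Z II ^+ 2 / L2norm mu II ^+ 2 <= L2norm mu R1 ^+ 2.
  by rewrite !sqr_L2norm// -R1II L2_cauchy_schwarz.
split.
- split=> //; first exact: L2orth_span1.
  exact: L2orth_span1.
- split=> //; first by rewrite VE pyth.
  (* The information bound drops the squared norm of [R1] from the Pythagorean split; the last
     conjunct of the theorem keeps its Cauchy-Schwarz lower bound instead. *)
  by rewrite VE IE lee_fin pyth lerDl sqr_ge0.
- split=> //; rewrite !sqr_L2norm// -R1II.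
  exact: L2_cauchy_schwarz_eq.
- by split=> //; rewrite VE IE -EFinD lee_fin pyth lerD2l.
Qed.
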